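(* Let $K$ be a field complete with respect to a discrete valuation $v$ of residue characteristic $p$, normalized so that $v(p)=1$. Let $\ell\ge2$ with $\ell\neq p$, $c\in\overline K$, $f(z)=z^\ell-c$ separable, $\alpha\in K$, and for $n\ge0$ let $K_n=K(\{\beta\in\overline K:f^n(\beta)=\alpha\})$, $K_\infty=\bigcup_{n\ge0}K_n$. Let $\nu_\infty=-\frac{\ell}{\ell-1}v(\ell)$. If $\nu_\infty\le v(c)<0$, then $K_\infty/K$ is infinitely wildly ramified.
   Context: $f^n$ is the $n$-fold composition of $f$. $K_\infty/K$ is infinitely wildly ramified if the $p$-parts of the ramification indices $e(K_n/K)$ are unbounded. *)

(* Defs.v *)
From HB Require Import structures.
From mathcomp Require Import all_boot all_order all_algebra separable.
From mathcomp Require Import boolp classical_sets functions cardinality.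
From mathcomp Require Import constructive_ereal.

Set Implicit Arguments.
Unset Strict Implicit.
Unset Printing Implicit Defensive.
Import Order.TTheory GRing.Theory Num.Theory.
Local Open Scope classical_set_scope.
Local Open Scope ring_scope.

(* Rank-one valuations, written additively. Values are taken in Q u {+oo}:
   a discrete valuation normalized by v(p) = 1 has value group (1/e)Z, and any
   extension of it to an algebraic extension has value group inside Q. The
   second field discards the value -oo of [\bar rat]. *)
Record is_valuation (F : fieldType) (v : F -> \bar rat) : Prop := IsValuation {
  valuation_eqy : forall x, v x = +oo%E <-> x = 0;
  valuation_neqNy : forall x, v x <> -oo%E;
  valuationM : forall x y, v (x * y) = (v x + v y)%E;
  valuationD : forall x y, (Order.min (v x) (v y) <= v (x + y)%R)%E
}.

Definition value_group (F : fieldType) (v : F -> \bar rat) (E : set F) :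
    set rat :=
  [set q | exists2 x, E x & v x = q%:E].

(* The value group is infinite cyclic; in particular v is nontrivial. *)
Definition discrete_valuation (F : fieldType) (v : F -> \bar rat) : Prop :=
  is_valuation v /\
  exists2 g : rat, 0 < g & value_group v setT = [set g *~ m | m in [set: int]].

Definition val_cauchy (F : fieldType) (v : F -> \bar rat) (u : nat -> F) :=
  forall B : rat, exists N : nat, forall m n : nat,
    (N <= m)%N -> (N <= n)%N -> (B%:E <= v (u m - u n)%R)%E.

Definition val_converges (F : fieldType) (v : F -> \bar rat) (u : nat -> F)
    (l : F) :=
  forall B : rat, exists N : nat, forall n : nat,
    (N <= n)%N -> (B%:E <= v (u n - l)%R)%E.

Definition val_complete (F : fieldType) (v : F -> \bar rat) : Prop :=
  forall u : nat -> F, val_cauchy v u -> exists l : F, val_converges v u l.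

(* p%:R vanishes in the residue field iff it has positive valuation, so this
   is [p \in [pchar k]] for the residue field k of v. *)
Definition residue_pchar (F : fieldType) (v : F -> \bar rat) (p : nat) : Prop :=
  prime p /\ (0 < v p%:R%R)%E.

Definition is_algebraic_closure (K : fieldType) (L : closedFieldType)
    (iota : {rmorphism K -> L}) : Prop :=
  forall x : L, algebraicOver iota x.

(* The subfield K(S) of L, where K is embedded in L by iota. *)
Definition adjoin (K L : fieldType) (iota : {rmorphism K -> L}) (S : set L) :
    set L :=
  smallest (fun E : set L => range iota `<=` E /\ divring_closed (mem E)) S.

(* K_n, generated over K by the solutions in L of f^n(beta) = alpha, where f^n
   is the n-fold composition. *)
Definition preimage_field (K L : fieldType) (iota : {rmorphism K -> L})
    (f : {poly L}) (alpha : K) (n : nat) : set L :=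
  adjoin iota [set beta | iter n (horner f) beta = iota alpha].

(* e(E/K) = e: there are exactly e cosets of v(K^* ) in w(E^* ), where w is an
   extension of v to L. *)
Definition has_ramification_index (K L : fieldType) (v : K -> \bar rat)
    (w : L -> \bar rat) (E : set L) (e : nat) : Prop :=
  ([set [set q + g | g in value_group v setT] | q in value_group w E] #= `I_e)%card.

(* Stated for the tower (K_n) that defines the infinite extension. *)
Definition infinitely_wildly_ramified (K L : fieldType) (v : K -> \bar rat)
    (w : L -> \bar rat) (p : nat) (Kn : nat -> set L) : Prop :=
  forall B : nat, exists n e : nat,
    has_ramification_index v w (Kn n) e /\ (B <= e`_p)%N.

Definition nu_infty (K : fieldType) (v : K -> \bar rat) (l : nat) : \bar rat :=
  (- ((l%:R / (l%:R - 1))%R%:E * v l%:R%R))%E.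

(* Main.v *)
(* Replacing alpha by an iterated preimage, assume every node x of the backward
   tree has w(x) = r := w(c)/l. For two backward orbits b_n, b'_n over the same
   point put s_n := w(b_n - b'_n) - r. With a = v_p(l) and D = -(l-1) r, so that
   0 < D <= a by hypothesis, the first slope of the Newton polygon of
   (b'_n + X)^l - b'_n^l - (b_(n-1) - b'_(n-1)) shows that the orbits can be
   continued with
     s_(n+1) = max_(0 <= j <= a) (s_n + D - a + j) / p^j,
   a strictly increasing function of s_n. If s_0 is not a fixed point, then
   (s_n) is strictly monotone and bounded, so its denominators are unbounded,
   and by the recursion only their p-part can grow. The initial s_0 is
   w(1 - z) for an l-th root of unity z: if D < a, any z with
   w(1 - z) >= 1/(p-1) works; if D = a, one needs w(1 - z) < 1/(p-1), and such
   a z exists since the product of all the 1 - z with z <> 1 is l, and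
   v(l) < (l-1)/(p-1) because l <> p. *)
Require Import Defs.
From mathcomp Require Import all_boot all_order all_algebra separable.
From mathcomp Require Import boolp classical_sets functions cardinality.
From mathcomp Require Import constructive_ereal.
From mathcomp Require Import zify ring lra.
Set Implicit Arguments.
Unset Strict Implicit.
Unset Printing Implicit Defensive.
Import Order.TTheory GRing.Theory Num.Theory.
Local Open Scope classical_set_scope.
Local Open Scope ring_scope.

(** * Rational-valued additive valuations and the ultrametric inequality *)

Section Valuation.
Variables (L : fieldType) (w : L -> \bar rat).
Hypothesis w_val : is_valuation w.

(* Junk value: [rval w 0 = 0]. *)
Definition rval (x : L) : rat := fine (w x).

(** The disjunct [x == 0] restores the infinite valuation of 0, which [rval] loses. *)
Definition vge (q : rat) (x : L) := (x == 0) || (q <= rval x).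
Definition vgt (q : rat) (x : L) := (x == 0) || (q < rval x).

Lemma rvalE x : x != 0 -> w x = (rval x)%:E.
Proof.
move=> x0; rewrite /rval; case E: (w x) => [r||] //.
  by move/(valuation_eqy w_val): E x0 => ->; rewrite eqxx.
by case: (valuation_neqNy w_val (x := x)).
Qed.

Lemma rvalM x y : x != 0 -> y != 0 -> rval (x * y) = rval x + rval y.
Proof. by move=> x0 y0; rewrite {1}/rval (valuationM w_val) !rvalE. Qed.

Lemma rval1 : rval 1 = 0.
Proof.
have := rvalM (oner_neq0 L) (oner_neq0 L); rewrite mulr1; lra.
Qed.

Lemma rvalV x : x != 0 -> rval x^-1 = - rval x.
Proof.
move=> x0; have := @rvalM x x^-1 x0.
rewrite invr_neq0 // divff // rval1 => /(_ isT); lra.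
Qed.

Lemma rvalX x n : x != 0 -> rval (x ^+ n) = n%:R * rval x.
Proof.
move=> x0; elim: n => [|n IH]; first by rewrite expr0 rval1 mul0r.
by rewrite exprS rvalM ?expf_neq0 // IH -natr1 mulrDl mul1r addrC.
Qed.

Lemma rvalN x : rval (- x) = rval x.
Proof.
have [->|x0] := eqVneq x 0; first by rewrite oppr0.
have N10 : (-1 : L) != 0 by rewrite oppr_eq0 oner_neq0.
rewrite -mulN1r rvalM //.
have := rvalM N10 N10; rewrite mulrNN mulr1 rval1; lra.
Qed.

Lemma vgt_vge q x : vgt q x -> vge q x.
Proof. by case/orP => [x0|/ltW H]; apply/orP; [left|right]. Qed.

Lemma vge_le q q' x : q <= q' -> vge q' x -> vge q x.
Proof.
by move=> qq' /orP[x0|H]; apply/orP; [left|right]; last exact: le_trans H.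
Qed.

Lemma vgtP q x : reflect (exists2 q', q < q' & vge q' x) (vgt q x).
Proof.
apply: (iffP orP) => [[/eqP ->|H]|[q' qq' /orP[x0|H]]].
- by exists (q + 1); [lra|rewrite /vge eqxx].
- by exists (rval x); rewrite // /vge lexx orbT.
- by left.
by right; exact: lt_le_trans H.
Qed.

Lemma vgeN q x : vge q (- x) = vge q x.
Proof. by rewrite /vge oppr_eq0 rvalN. Qed.

Lemma vgeM q q' x y : vge q x -> vge q' y -> vge (q + q') (x * y).
Proof.
have [->|x0] := eqVneq x 0; first by rewrite mul0r /vge eqxx.
have [->|y0] := eqVneq y 0; first by rewrite mulr0 /vge eqxx.
rewrite /vge mulf_eq0 (negbTE x0) (negbTE y0) /= rvalM //; lra.
Qed.

Lemma vgeD q x y : vge q x -> vge q y -> vge q (x + y).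
Proof.
have [->|x0] := eqVneq x 0; first by rewrite add0r.
have [->|y0] := eqVneq y 0; first by rewrite addr0.
have [xy0|xy0] := eqVneq (x + y) 0; first by rewrite /vge xy0 eqxx.
rewrite /vge (negbTE x0) (negbTE y0) (negbTE xy0) /= => qx qy.
have := valuationD w_val x y; rewrite !rvalE // => H.
rewrite -lee_fin; apply: le_trans H.
by rewrite le_min !lee_fin qx.
Qed.

Lemma vgtD q x y : vgt q x -> vgt q y -> vgt q (x + y).
Proof.
move=> /vgtP[q1 H1 X] /vgtP[q2 H2 Y]; apply/vgtP; exists (Num.min q1 q2).
  by rewrite lt_min H1.
by apply: vgeD; [apply: (vge_le _ X)|apply: (vge_le _ Y)]; rewrite ge_min lexx ?orbT.
Qed.

Lemma vgt_sum (I : Type) (r : seq I) (P : pred I) (F : I -> L) q :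
  (forall i, P i -> vgt q (F i)) -> vgt q (\sum_(i <- r | P i) F i).
Proof.
move=> H; apply: (big_ind (vgt q)) => //; last exact: vgtD.
by rewrite /vgt eqxx.
Qed.

Lemma vgt_irrefl x : x != 0 -> ~~ vgt (rval x) x.
Proof. by move=> x0; rewrite /vgt (negbTE x0) ltxx. Qed.

(** If [x + y] also had valuation above that of [x], then so would [x = (x + y) - y]. *)
Lemma rval_addl x y : x != 0 -> vgt (rval x) y ->
  x + y != 0 /\ rval (x + y) = rval x.
Proof.
move=> x0 xy.
have xy0 : x + y != 0.
  apply/eqP => /eqP; rewrite addr_eq0 => /eqP xE.
  by move: (vgt_irrefl x0); rewrite {2}xE /vgt oppr_eq0 rvalN -/(vgt _ _) xy.
split=> //; apply/eqP; rewrite eq_le; apply/andP; split; last first.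
  have : vge (rval x) (x + y).
    by apply: vgeD; [rewrite /vge lexx orbT|exact: vgt_vge].
  by rewrite /vge (negbTE xy0).
rewrite leNgt; apply/negP => H; move/negP: (vgt_irrefl x0); apply.
have -> : vgt (rval x) x = vgt (rval x) ((x + y) + - y) by rewrite addrK.
apply: vgtD; first by rewrite /vgt H orbT.
by rewrite /vgt oppr_eq0 rvalN.
Qed.

(** A single term of least valuation would dominate the sum by [rval_addl] and keep it nonzero, so
    the minimum is attained twice. *)
Lemma sum0_rval_eq (n : nat) (t : 'I_n -> L) (i0 : 'I_n) :
  \sum_i t i = 0 -> t i0 != 0 ->
  exists i j : 'I_n, [/\ (i < j)%N, t i != 0, t j != 0 & rval (t i) = rval (t j)].
Proof.
move=> sum0 ti0.
case: (arg_minP (P := fun i => t i != 0) (fun i => rval (t i)) ti0) => i ti imin.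
suff [j ji [tj E]] : exists2 j, j != i & t j != 0 /\ rval (t j) = rval (t i).
  case: (ltngtP i j) => [ij|ij|/val_inj ij].
  - by exists i, j.
  - by exists j, i.
  - by rewrite ij eqxx in ji.
apply: contrapT => H; move: sum0; rewrite (bigD1 i) //= => /eqP.
apply/negP; apply: (proj1 (rval_addl ti _)).
apply: vgt_sum => j ji; rewrite /vgt.
have [_ //|tj /=] := eqVneq (t j) 0.
rewrite lt_neqAle imin // andbT; apply/eqP => E.
by apply: H; exists j.
Qed.

(** Up to sign, the coefficient of degree [i] is a sum of products of all but [i] of the roots, and
    each omitted root lowers the valuation by at most [lam]. *)
Lemma prod_XsubC_coef_vge (s : seq L) (lam : rat) (P := \prod_(d <- s) ('X - d%:P)) :
  (forall d, d \in s -> d != 0 /\ rval d <= lam) ->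
  P`_0 != 0 /\ forall i, vge (rval P`_0 - i%:R * lam) P`_i.
Proof.
rewrite {}/P; elim: s => [_|d s IH H].
  rewrite big_nil coef1 oner_neq0; split=> // -[|i]; rewrite coef1 //=.
    by rewrite /vge mul0r subr0 lexx orbT.
  by rewrite /vge eqxx.
have [e es|{IH} P0 IH] := IH; first by apply: H; rewrite inE es orbT.
have [d0 dlam] := H d (mem_head _ _).
rewrite big_cons; set P := \prod_(_ <- _) _ in P0 IH *.
have c0 : (('X - d%:P) * P)`_0 = - (d * P`_0).
  by rewrite mulrBl coefB coefXM coefCM sub0r.
rewrite c0 oppr_eq0 mulf_neq0 //; split=> // i.
rewrite rvalN rvalM // mulrBl coefB coefXM coefCM.
apply: vgeD; last first.
  rewrite vgeN; apply: (vge_le _ (vgeM (x := d) (q := rval d) _ (IH i))).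
    by rewrite addrA.
  by rewrite /vge lexx orbT.
case: i => [|i] /=; first by rewrite /vge eqxx.
apply: (vge_le _ (IH i)); rewrite -natr1; lra.
Qed.

End Valuation.
Arguments rvalE [L w] _ [x].

(** * Newton polygons and roots of largest valuation *)

Lemma exists_max_seq (T : eqType) (f : T -> rat) (s : seq T) : s != [::] ->
  exists2 m, m \in s & forall x, x \in s -> f x <= f m.
Proof.
elim: s => // x [|y s] IH _.
  by exists x; rewrite ?mem_head // => z; rewrite inE => /eqP ->.
have [//|m ms H] := IH; have [xm|mx] := leP (f x) (f m).
  by exists m => [|z]; rewrite inE ?ms ?orbT // => /orP[/eqP ->|/H].
exists x => [|z]; rewrite inE ?eqxx // => /orP[/eqP ->//|/H zm].
exact: le_trans zm (ltW mx).
Qed.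

(* The first slope of the Newton polygon of [P]. *)
Lemma largest_root (L : closedFieldType) (w : L -> \bar rat)
    (w_val : is_valuation w) (P : {poly L}) :
  P`_0 != 0 -> (1 < size P)%N ->
  exists d, [/\ d != 0, root P d,
    forall i, vge w (rval w P`_0 - i%:R * rval w d) P`_i &
    exists i : nat, [/\ (0 < i)%N, P`_i != 0 &
      rval w P`_i = rval w P`_0 - i%:R * rval w d]].
Proof.
move=> P0 szP; have [s Ps] := closed_field_poly_normal P.
have Pn0 : P != 0 by apply: contraNneq P0 => ->; rewrite coef0.
set a := lead_coef P in Ps; have a0 : a != 0 by rewrite lead_coef_eq0.
have rootP z : z \in s -> root P z.
  by move=> zs; rewrite Ps rootZ // root_prod_XsubC.
have sn0 : s != [::].
  apply: contraTneq szP => s0.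
  by rewrite Ps s0 big_nil size_scale // size_poly1.
have sn00 z : z \in s -> z != 0.
  by move/rootP; apply: contraTneq => ->; rewrite rootE horner_coef0.
have [d ds dmax] := exists_max_seq (rval w) sn0.
have [] := @prod_XsubC_coef_vge _ _ w_val s (rval w d).
  by move=> z zs; rewrite sn00 // dmax.
set Q := \prod_(_ <- s) _ in Ps *; move=> Q0 HQ.
have d0 := sn00 _ ds.
have vP i : vge w (rval w P`_0 - i%:R * rval w d) P`_i.
  rewrite Ps !coefZ rvalM // -addrA; apply: vgeM => //.
  by rewrite /vge lexx orbT.
exists d; split=> //; first exact: rootP.
(* If no other coefficient met the line, the constant term would have strictly least valuation in
   [P.[d]], which could not vanish. *)
apply: contrapT => H; have := rootP _ ds; rewrite rootE horner_coef.
case E: (size P) szP => [//|n] _; rewrite big_ord_recl /= expr0 mulr1.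
apply/negP; apply: (proj1 (rval_addl w_val P0 _)); apply: vgt_sum => // i _.
rewrite /bump /= add1n /vgt mulf_eq0 expf_eq0 (negbTE d0) andbF orbF.
have [_ //|Pi0 /=] := eqVneq P`_i.+1 0.
rewrite rvalM ?expf_neq0 // rvalX //.
have := vP i.+1; rewrite /vge (negbTE Pi0) /= le_eqVlt => /orP[/eqP E1|]; last lra.
by case: H; exists i.+1.
Qed.

(** * Valuations of natural numbers *)

Section MixedCharacteristic.
Variables (L : fieldType) (w : L -> \bar rat) (p : nat).
Hypotheses (w_val : is_valuation w) (p_prime : prime p) (wp : w p%:R = 1%E).

Lemma natr_p_neq0 : (p%:R : L) != 0.
Proof.
by apply/eqP => p0; move: wp; rewrite p0 (proj2 (valuation_eqy w_val _)).
Qed.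

Lemma vge0_nat n : vge w 0 n%:R.
Proof.
elim: n => [|n IH]; first by rewrite /vge eqxx.
rewrite -natr1; apply: vgeD => //.
by rewrite /vge rval1 // lexx orbT.
Qed.

Lemma rval_coprime n : coprime n p -> n%:R != 0 :> L /\ rval w n%:R = 0.
Proof.
move=> cnp; have n0 : (0 < n)%N.
  case: n cnp => //; rewrite /coprime gcd0n => /eqP p1.
  by move: p_prime; rewrite p1.
have rp : rval w p%:R = 1 by rewrite /rval wp.
have vbp b : vgt w 0 (- (b%:R * p%:R)).
  apply/(vgtP w); exists (0 + rval w p%:R); first by rewrite rp.
  rewrite vgeN //; apply: vgeM => //; first exact: vge0_nat.
  by rewrite /vge lexx orbT.
(* Bezout writes 1 as [a * n - b * p]; if [n] had positive valuation, so would 1. *)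
case: (egcdnP p n0) => a b; rewrite (eqP cnp) => E _.
have E' : (a%:R * n%:R + - (b%:R * p%:R) : L) = 1.
  by rewrite -!natrM E natrD addrAC subrr add0r.
have absurd : vgt w 0 (n%:R) -> False.
  move=> /(vgtP w)[q q0 vn].
  suff : vgt w (rval w 1) 1 by apply/negP/vgt_irrefl/oner_neq0.
  rewrite rval1 // -E'; apply: vgtD => //.
  apply/(vgtP w); exists (0 + q); first by rewrite add0r.
  by apply: vgeM => //; exact: vge0_nat.
have nn0 : n%:R != 0 :> L by apply/negP => n00; apply: absurd; rewrite /vgt n00.
split=> //; apply/eqP; rewrite eq_le; apply/andP; split.
  by rewrite leNgt; apply/negP => H; apply: absurd; rewrite /vgt H orbT.
by have := vge0_nat n; rewrite /vge (negbTE nn0).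
Qed.

Lemma rval_nat n : (0 < n)%N -> n%:R != 0 :> L /\ rval w n%:R = (logn p n)%:R.
Proof.
move=> n0; have [m pm En] := pfactor_coprime p_prime n0.
have [|m0 rm] := @rval_coprime m; first by rewrite coprime_sym.
rewrite {1 2}En natrM natrX.
have p0 := natr_p_neq0.
rewrite mulf_neq0 ?expf_neq0 //; split=> //.
by rewrite rvalM ?expf_neq0 // rm rvalX // {1}/rval wp add0r mulr1.
Qed.

End MixedCharacteristic.

(** * p-adic valuations of binomial coefficients *)

Lemma logn_bin_ge p n i : (0 < i <= n)%N ->
  (logn p n <= logn p 'C(n, i) + logn p i)%N.
Proof.
case: i => // i /= ilen; have := mul_bin_diag n i => E.
have n0 : (0 < n)%N by exact: leq_ltn_trans ilen.
have Cn0 : (0 < 'C(n, i.+1))%N by rewrite bin_gt0.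
have Cn1 : (0 < 'C(n.-1, i))%N by rewrite bin_gt0; case: n ilen {E n0 Cn0}.
have := congr1 (logn p) E; rewrite !lognM //; lia.
Qed.

(** Induction on [k] by Pascal's rule: [p] divides C(n, k + 1) as long as k + 1 < p^v_p(n), so C(n -
    1, k + 1) and -C(n - 1, k) agree modulo [p]. *)
Lemma bin_pred_not_dvd p n k : prime p -> (0 < n)%N -> (k < p ^ logn p n)%N ->
  ~~ (p %| 'C(n.-1, k))%N.
Proof.
move=> p_prime n0; elim: k => [_|k IH kp].
  by rewrite bin0 dvdn1; case: p p_prime => [|[]].
have kn : (k < n)%N.
  by apply: leq_trans (ltnW kp) _; apply: dvdn_leq => //; exact: pfactor_dvdnn.
have pC : (p %| 'C(n, k.+1))%N.
  have : (0 < logn p 'C(n, k.+1))%N.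
    have H := @logn_bin_ge p n k.+1; rewrite /= kn in H; have {}H := H isT.
    have : (logn p k.+1 < logn p n)%N.
      rewrite -(ltn_exp2l _ _ (prime_gt1 p_prime)).
      by apply: leq_ltn_trans kp; apply: dvdn_leq => //; exact: pfactor_dvdnn.
    lia.
  by rewrite logn_gt0 mem_primes => /and3P[].
apply/negP => pk1; move/negP: (IH (ltnW kp)); apply.
move: pC; rewrite -{1}(prednK n0) binS dvdn_addr //.
Qed.

(** In p^j C(n, p^j) = n C(n - 1, p^j - 1) the last factor is prime to [p]. *)
Lemma logn_bin_exp p n j : prime p -> (0 < n)%N -> (j <= logn p n)%N ->
  (logn p 'C(n, p ^ j) = logn p n - j)%N.
Proof.
move=> p_prime n0 jn; have p0 := prime_gt0 p_prime.
have pj0 : (0 < p ^ j)%N by rewrite expn_gt0 p0.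
have pn : (p ^ logn p n <= n)%N by apply: dvdn_leq => //; exact: pfactor_dvdnn.
have pjn : (p ^ j <= n)%N by apply: leq_trans pn; rewrite leq_pexp2l.
have := congr1 (logn p) (mul_bin_diag n (p ^ j).-1).
rewrite prednK // !lognM ?bin_gt0 ?pfactorK //; last by lia.
have -> : logn p 'C(n.-1, (p ^ j).-1) = 0%N.
  have /negbTE H : ~~ (p %| 'C(n.-1, (p ^ j).-1))%N.
    by apply: bin_pred_not_dvd => //; rewrite prednK // leq_pexp2l.
  by rewrite lognE H !andbF.
lia.
Qed.

Lemma expn_ge_linear p j : (0 < p)%N -> (j * p.-1 < p ^ j)%N.
Proof. by move=> p0; elim: j => // j IH; rewrite expnS; nia. Qed.

(** For [l = p] there is equality. When [l] is exactly the power p^v_p(l), [l <> p] forces the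
    exponent to be at least 2, which leaves room for strictness. *)
Lemma logn_mul_pred_lt p l : prime p -> (p %| l)%N -> l <> p -> (0 < l)%N ->
  (logn p l * p.-1 < l.-1)%N.
Proof.
move=> p_prime pl lp l0; have p1 := prime_gt1 p_prime.
have a0 : (0 < logn p l)%N by rewrite logn_gt0 mem_primes p_prime l0.
have pal : (p ^ logn p l %| l)%N by exact: pfactor_dvdnn.
have := dvdn_leq l0 pal; rewrite leq_eqVlt => /orP[/eqP lE|].
  move: a0 lE; case: (logn p l) => [//|[|a]] _ lE.
    by case: lp; rewrite -lE expn1.
  have := @expn_ge_linear p a.+1 (ltnW p1).
  by move: lE; rewrite (expnS p a.+1); nia.
have := @expn_ge_linear p (logn p l) (ltnW p1); lia.
Qed.

(* The largest valuation of a root is given by the points of the Newton polygon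
   of abscissa [p ^ j]; [a] is the valuation of the degree. *)
Definition newton_step (p a : nat) (D s t : rat) : Prop :=
  (exists2 j, (j <= a)%N & (p ^ j)%:R * t = s + D - a%:R + j%:R) /\
  (forall j, (j <= a)%N -> s + D - a%:R + j%:R <= (p ^ j)%:R * t).

(** * Orbits of the recursion [newton_step] and their denominators *)

Section NewtonOrbit.
Variables (p a : nat) (D : rat).
Hypothesis p_prime : prime p.

Let p_gt0 : 0 < p%:R :> rat.
Proof. by rewrite ltr0n prime_gt0. Qed.

Let pX_gt0 j : 0 < (p ^ j)%:R :> rat.
Proof. by rewrite natrX exprn_gt0. Qed.

Let pX_ge_linear j : j%:R * (p%:R - 1) + 1 <= (p ^ j)%:R :> rat.
Proof.
have := expn_ge_linear j (prime_gt0 p_prime).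
rewrite -(ler_nat rat) -natr1 natrM -(natrB _ (prime_gt0 p_prime)) subn1.
by [].
Qed.

(** At an index [j] where the maximum for [s] is attained, the value for [s'] is already larger. *)
Lemma newton_step_lt s s' t t' :
  newton_step p a D s t -> newton_step p a D s' t' -> s < s' -> t < t'.
Proof.
move=> [[j ja E] _] [_ /(_ j ja) H] ss'.
by rewrite -(ltr_pM2l (pX_gt0 j)) E; apply: lt_le_trans H; lra.
Qed.

Lemma newton_step_gt0 s t : 0 <= s -> 0 < D -> newton_step p a D s t -> 0 < t.
Proof.
move=> s0 D0 [_ /(_ a (leqnn _)) H].
by rewrite -(pmulr_rgt0 _ (pX_gt0 a)); apply: lt_le_trans H; lra.
Qed.

(** The integers [N%:R * u n] would grow by at least 1 at each step, past any bound. *)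
Lemma increasing_bounded_not_int (u : nat -> rat) (b : rat) (N : nat) :
  (0 < N)%N -> (forall n, u n < u n.+1) -> (forall n, u n <= b) ->
  ~ (forall n, N%:R * u n \is a Num.int).
Proof.
move=> N0 u_incr u_bound u_int.
have N0' : 0 < N%:R :> rat by rewrite ltr0n.
have H n : N%:R * u 0%N + n%:R <= N%:R * u n.
  elim: n => [|n IH]; first by rewrite addr0.
  have : N%:R * u n < N%:R * u n.+1 by rewrite ltr_pM2l.
  move: IH; have /intrP[i ->] := u_int n; have /intrP[k ->] := u_int n.+1.
  rewrite ltr_int -lezD1 -(ler_int rat) rmorphD /= -natr1; lra.
have := archi_boundP (normr_ge0 (N%:R * (b - u 0%N))).
set n := Num.bound _; have := H n; have : N%:R * u n <= N%:R * b by rewrite ler_pM2l.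
have := ler_norm (N%:R * (b - u 0%N)); lra.
Qed.

Variable s : nat -> rat.
Hypothesis D_gt0 : 0 < D.
Hypothesis s_step : forall n, newton_step p a D (s n) (s n.+1).
Hypothesis s0_ge0 : 0 <= s 0%N.
Hypothesis s0_not_fixed :
  D < a%:R /\ 1 <= (p%:R - 1) * s 0%N \/ D = a%:R /\ (p%:R - 1) * s 0%N < 1.

Let p1_ge1 : 1 <= p%:R - 1 :> rat.
Proof.
have := prime_gt1 p_prime; rewrite -(ler_nat rat) -natr1; lra.
Qed.

Lemma newton_orbit_ge0 n : 0 <= s n.
Proof.
by elim: n => // n IH; exact: ltW (newton_step_gt0 IH D_gt0 (s_step n)).
Qed.

Lemma newton_orbit_not_int N : (0 < N)%N -> ~ (forall n, N%:R * s n \is a Num.int).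
Proof.
move=> N0 s_int; case: s0_not_fixed => [[Da s0]|[Da s0]].
  apply: (@increasing_bounded_not_int (fun n => - s n) 0 N) => //.
  - elim=> [|n IH]; last first.
      by rewrite ltrN2; apply: newton_step_lt (s_step _) (s_step _) _; rewrite -ltrN2.
    (* The first step decreases: s_0 + D - a + j < s_0 + j <= (1 + j(p - 1)) s_0 <= p^j s_0. *)
    rewrite ltrN2; case: (s_step 0) => [[j ja E] _].
    rewrite -(ltr_pM2l (pX_gt0 j)) E.
    have := ler_wpM2r s0_ge0 (pX_ge_linear j).
    have := ler_wpM2l (ler0n rat j) s0; rewrite mulr1 mulrA; lra.
  - by move=> n; rewrite oppr_le0 newton_orbit_ge0.
  - by move=> n; rewrite mulrN rpredN.
have a0 : (0 < a)%N by rewrite -(ltr0n rat) -Da.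
(* The fixed point 1/(p - 1) remains a strict upper bound, since (p - 1)(s_n + j) < 1 + j(p - 1) <=
   p^j. *)
have s_lt n : (p%:R - 1) * s n < 1.
  elim: n => // n IH; case: (s_step n) => [[j ja E] _].
  rewrite -(ltr_pM2l (pX_gt0 j)) mulrCA E Da mulr1.
  have := pX_ge_linear j; lra.
apply: (@increasing_bounded_not_int s 1 N) => //.
- elim=> [|n IH]; last exact: newton_step_lt (s_step _) (s_step _) IH.
  (* The term [j = 1] gives p s_1 >= s_0 + 1 > p s_0. *)
  case: (s_step 0) => [_ /(_ _ a0)]; rewrite Da expn1 => H.
  rewrite -(ltr_pM2l p_gt0); lra.
- move=> n; have := ler_wpM2r (newton_orbit_ge0 n) p1_ge1.
  have := s_lt n; lra.
Qed.

(** [M] clears the denominators of s_0 and [D]; after that, each step divides only by a power of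
    [p]. *)
Lemma newton_orbit_denominators :
  exists2 M, (0 < M)%N & forall n, exists t, (p ^ t * M)%:R * s n \is a Num.int.
Proof.
pose M := (`|denq (s 0%N)| * `|denq D|)%N; exists M.
  by rewrite muln_gt0 !absz_gt0 !denq_neq0.
have Mden (x : rat) : `|denq x|%:R * x \is a Num.int.
  by rewrite natr_absz ger0_norm // mulrC -numqE.
have MD : M%:R * D \is a Num.int by rewrite natrM -mulrA rpredM ?natr_int.
elim=> [|n [t IH]].
  by exists 0%N; rewrite mul1n natrM mulrAC rpredM ?natr_int.
case: (s_step n) => [[j ja E] _]; exists (t + j)%N.
have -> : (p ^ (t + j) * M)%:R * s n.+1 =
  (p ^ t * M)%:R * s n + (p ^ t)%:R * (M%:R * D)
  + (p ^ t * M)%:R * (j%:R - a%:R).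
  transitivity ((p ^ t * M)%:R * ((p ^ j)%:R * s n.+1)).
    by rewrite expnD !natrM; ring.
  by rewrite E !natrM; ring.
apply: rpredD; first apply: rpredD => //.
  by apply: rpredM => //; exact: natr_int.
by apply: rpredM; rewrite ?rpredB ?natr_int.
Qed.

Lemma coprime_int m n (x : rat) : (0 < m)%N -> coprime m n ->
  m%:R * x \is a Num.int -> n%:R * x \is a Num.int -> x \is a Num.int.
Proof.
move=> m0 cmn mx nx; case: (egcdnP n m0) => b c; rewrite (eqP cmn) => E _.
have -> : x = b%:R * (m%:R * x) - c%:R * (n%:R * x).
  by rewrite !mulrA -!natrM E natrD; ring.
by apply: rpredB; apply: rpredM => //; exact: natr_int.
Qed.

(** If the p-parts of the [e n] were bounded, E p^B M would clear every [s n], against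
    [newton_orbit_not_int]. Indeed E p^B M s_n becomes integral after multiplication by the
    prime-to-p part of [e n], and also after multiplication by a power of [p]. *)
Lemma newton_orbit_ramified (E : nat) (e : nat -> nat) (B : nat) :
  (0 < E)%N -> (forall n, (0 < e n)%N) ->
  (forall n, (E * e n)%:R * s n \is a Num.int) ->
  exists n, (B <= (e n)`_p)%N.
Proof.
move=> E0 e0 es_int; apply: contrapT => H.
have [M M0 sM] := newton_orbit_denominators.
apply: (@newton_orbit_not_int (E * p ^ B * M)) => [|n].
  by rewrite !muln_gt0 E0 M0 expn_gt0 prime_gt0.
have lB : (logn p (e n) <= B)%N.
  apply: ltnW; apply: leq_ltn_trans (ltnW (ltn_expl _ (prime_gt1 p_prime))) _.
  by rewrite -p_part ltnNge; apply/negP => Hn; apply: H; exists n.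
have [u pu En] := pfactor_coprime p_prime (e0 n).
have [t pt] := sM n.
have u0 : (0 < u)%N by move: (e0 n); rewrite En muln_gt0 => /andP[].
apply: (@coprime_int u (p ^ t)) => //.
- by rewrite coprime_sym coprimeXl.
- have -> : u%:R * ((E * p ^ B * M)%:R * s n) =
    (p ^ (B - logn p (e n)) * M)%:R * ((E * e n)%:R * s n).
    rewrite {2}En -{1}(subnK lB) expnD !natrM; ring.
  by rewrite rpredM ?natr_int.
- have -> : (p ^ t)%:R * ((E * p ^ B * M)%:R * s n) =
    (E * p ^ B)%:R * ((p ^ t * M)%:R * s n) by rewrite !natrM; ring.
  by rewrite rpredM ?natr_int.
Qed.

End NewtonOrbit.

(** * Nearest preimages under z^l - c, and roots of unity near to and far from 1 *)

Section BackwardOrbit.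
Variables (L : closedFieldType) (w : L -> \bar rat) (p : nat).
Hypotheses (w_val : is_valuation w) (p_prime : prime p) (wp : w p%:R = 1%E).

(** Take b = b' + d with d the root of largest valuation of (b' + X)^l - (x + c). Its coefficient of
    degree i > 0 has valuation (l - i) r + v(C(l, i)), and the known valuations of binomials leave
    only the abscissas p^j to compare. *)
Lemma exists_newton_preimage (l : nat) (c x x' b' : L) (r := rval w b') :
  (1 < l)%N -> b' != 0 -> b' ^+ l = x' + c -> x != x' ->
  r < 0 -> r <= rval w (x - x') ->
  exists b, [/\ b ^+ l = x + c, b != b' &
    newton_step p (logn p l) (- (l%:R - 1) * r)
      (rval w (x - x') - r) (rval w (b - b') - r)].
Proof.
move=> l1 b'0 b'l xx' r0 rx; have l0 : (0 < l)%N by exact: ltnW.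
(* The constant coefficient b'^l - (x + c) is entered directly as x' - x. *)
pose P := \poly_(i < l.+1)
  (if i == 0%N then x' - x else b' ^+ (l - i) *+ 'C(l, i)).
have PE d : P.[d] = (b' + d) ^+ l - (x + c).
  rewrite horner_poly exprDn !big_ord_recl /= !expr0 !mulr1 bin0 mulr1n subn0 b'l.
  set S := \sum_(i < l) _; set T := \sum_(i < l) _.
  have -> : S = T.
    apply: eq_bigr => i _; rewrite /bump /= add1n.
    by rewrite mulrnAl.
  ring.
have P0E : P`_0 = x' - x by rewrite coef_poly.
have P0 : P`_0 != 0 by rewrite P0E subr_eq0 eq_sym.
have vP0 : rval w P`_0 = rval w (x - x') by rewrite P0E -opprB rvalN.
have PiE i : (0 < i <= l)%N -> P`_i != 0 /\
    rval w P`_i = (l%:R - i%:R) * r + (logn p 'C(l, i))%:R.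
  move=> /andP[i0 il]; rewrite coef_poly ltnS il gtn_eqF //.
  have /(rval_nat w_val p_prime wp)[C0 vC] : (0 < 'C(l, i))%N by rewrite bin_gt0.
  rewrite -mulr_natr mulf_neq0 ?expf_neq0 //; split=> //.
  by rewrite rvalM ?expf_neq0 // rvalX // natrB // vC.
have szP : (1 < size P)%N.
  have [|Pl0 _] := PiE l; first by rewrite l0 leqnn.
  apply: leq_ltn_trans (l0) _; rewrite ltnNge; apply/negP => /leq_sizeP H.
  by rewrite H ?eqxx in Pl0.
have [d [d0 Pd vd [i [i0 Pi0 vi]]]] := largest_root w_val P0 szP.
exists (b' + d); rewrite addrAC subrr add0r; split.
- by apply/eqP; rewrite -subr_eq0 -PE.
- by rewrite -subr_eq0 addrAC subrr add0r.
rewrite vP0 in vd vi.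
set s := rval w (x - x') - r; set t := rval w d - r; set D := - _ * r.
have xE : rval w (x - x') = s + r by rewrite /s subrK.
have dE : rval w d = t + r by rewrite /t subrK.
rewrite xE dE in vd vi.
have s0 : 0 <= s by rewrite /s subr_ge0.
have D0 : 0 < D by rewrite /D mulNr -mulrN mulr_gt0 ?oppr_gt0 // subr_gt0 ltr1n.
have il : (i <= l)%N.
  by rewrite leqNgt; apply: contra Pi0 => li; rewrite coef_poly ltnS leqNgt li eqxx.
set a := logn p l.
have step j : (j <= a)%N -> s + D - a%:R + j%:R <= (p ^ j)%:R * t.
  move=> ja; have pl : (0 < p ^ j <= l)%N.
    rewrite expn_gt0 prime_gt0 //=; apply: dvdn_leq => //.
    by apply: dvdn_trans (pfactor_dvdnn p l); exact: dvdn_exp2l.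
  have [P1 vP1] := PiE _ pl.
  have := vd (p ^ j)%N; rewrite /vge (negbTE P1) /= vP1 logn_bin_exp // natrB //.
  rewrite /D; lra.
have t0 : 0 < t.
  have pa0 : 0 < (p ^ a)%:R :> rat by rewrite ltr0n expn_gt0 prime_gt0.
  by rewrite -(pmulr_rgt0 _ pa0); apply: lt_le_trans (step a (leqnn _)); lra.
(* The abscissa [i] on the first slope is replaced by p^j: since p^j <= i, t > 0 and v(C(l, i)) >= a
   - j, one gets p^j t <= i t <= s + D - a + j. *)
split=> //; pose j := minn (logn p i) a; exists j; first exact: geq_minr.
apply/eqP; rewrite eq_le step ?geq_minr // andbT.
have [|_ vPi] := PiE i; first by rewrite i0.
have pji : (p ^ j)%:R * t <= i%:R * t.
  rewrite ler_pM2r // ler_nat; apply: dvdn_leq => //.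
  by apply: dvdn_trans (pfactor_dvdnn p i); apply: dvdn_exp2l; exact: geq_minl.
have aC : a%:R <= (logn p 'C(l, i))%:R + j%:R :> rat.
  have := @logn_bin_ge p l i; rewrite i0 il => /(_ isT) aC.
  by rewrite -natrD ler_nat addn_minr leq_min aC leq_addl.
move: vi; rewrite vPi /D; lra.
Qed.

Lemma rval_unit_root_sub1 (l : nat) (d : L) : (0 < l)%N -> (1 + d) ^+ l = 1 ->
  vge w 0 d.
Proof.
move=> l0 dl; have d10 : 1 + d != 0.
  apply/eqP => d10; move: dl; rewrite d10 expr0n gtn_eqF // => /esym/eqP.
  by rewrite oner_eq0.
have v1 : rval w (1 + d) = 0.
  have := rvalX w_val l d10; rewrite dl rval1 // => /esym/eqP.
  by rewrite mulf_eq0 pnatr_eq0 gtn_eqF //= => /eqP.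
have -> : d = (1 + d) + - 1 by ring.
apply: vgeD; rewrite ?vgeN // /vge ?v1 ?rval1 // lexx orbT //.
Qed.

Lemma prod_root_rval (s : seq L) (k : rat) :
  (forall z, z \in s -> z != 0 /\ 1 <= k * rval w z) ->
  \prod_(z <- s) (- z) != 0 /\ (size s)%:R <= k * rval w (\prod_(z <- s) (- z)).
Proof.
elim: s => [_|z s IH H].
  by rewrite big_nil oner_neq0 rval1 // mulr0.
have [z0 kz] := H z (mem_head _ _).
have [y ys|s0 ks] := IH; first by apply: H; rewrite inE ys orbT.
rewrite big_cons mulf_neq0 ?oppr_eq0 //; split=> //=.
rewrite rvalM ?oppr_eq0 // rvalN // mulrDr -natr1; lra.
Qed.

(* The coefficients of ((1 + X) ^ l - 1) / X. *)
Let unity_poly (l : nat) : {poly L} := \poly_(i < l) 'C(l, i.+1)%:R.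

Let unity_polyE l d : (1 + d) ^+ l = 1 + d * (unity_poly l).[d].
Proof.
rewrite exprDn big_ord_recl /= expr1n expr0 bin0 mulr1n mulr1; congr (_ + _).
rewrite horner_poly mulr_sumr; apply: eq_bigr => i _.
by rewrite /bump /= add1n expr1n mul1r exprS -mulr_natr; ring.
Qed.

Let unity_coef l i : (i < l)%N -> (unity_poly l)`_i != 0 /\
  rval w (unity_poly l)`_i = (logn p 'C(l, i.+1))%:R.
Proof.
by move=> il; rewrite coef_poly il; apply: rval_nat => //; rewrite bin_gt0.
Qed.

Let unity_root l d : (0 < l)%N -> root (unity_poly l) d ->
  d != 0 /\ (1 + d) ^+ l = 1.
Proof.
move=> l0 rd; split; last by rewrite unity_polyE (eqP rd) mulr0 addr0.
apply: contraTneq rd => ->; rewrite rootE horner_coef0.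
exact: (proj1 (unity_coef l0)).
Qed.

(** The root of largest valuation of ((1 + X)^l - 1)/X works: its coefficients of degrees 0 and p -
    1 have valuations v_p(l) and v_p(l) - 1. *)
Lemma exists_unity_root_near l : (p %| l)%N -> (0 < l)%N ->
  exists d : L, [/\ d != 0, (1 + d) ^+ l = 1 & 1 <= (p%:R - 1) * rval w d].
Proof.
move=> pl l0; have pl' := dvdn_leq l0 pl; have p1 := prime_gt1 p_prime.
have a0 : (0 < logn p l)%N by rewrite logn_gt0 mem_primes p_prime l0.
have [||d [d0 rd vd _]] := @largest_root _ _ w_val (unity_poly l).
- exact: (proj1 (unity_coef l0)).
- have [|u0 _] := @unity_coef l l.-1; first by rewrite prednK.
  apply: leq_ltn_trans (_ : l.-1 < _)%N; first by lia.
  by rewrite ltnNge; apply: contra u0 => /leq_sizeP ->.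
exists d; have [_ dl] := unity_root l0 rd; split=> //.
have [|u0 vu] := @unity_coef l p.-1; first by rewrite prednK // ltnW.
have := vd p.-1; rewrite /vge (negbTE u0) /= vu (proj2 (unity_coef l0)) bin1.
rewrite prednK ?(ltnW p1) // -[in 'C(l, p)](expn1 p) logn_bin_exp //.
by rewrite !natrB ?(ltnW p1) // -subn1 natrB ?(ltnW p1) //; lra.
Qed.

(** Otherwise the product of the l - 1 negated roots of ((1 + X)^l - 1)/X, which is l, would satisfy
    (p - 1) v(l) >= l - 1, against [logn_mul_pred_lt]. *)
Lemma exists_unity_root_far l : (p %| l)%N -> (0 < l)%N -> l <> p ->
  exists d : L, [/\ d != 0, (1 + d) ^+ l = 1 & (p%:R - 1) * rval w d < 1].
Proof.
move=> pl l0 lp; have p1 := prime_gt1 p_prime.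
have [s Qs] := closed_field_poly_normal (unity_poly l).
have szQ : size (unity_poly l) = l.
  apply/eqP; rewrite eqn_leq size_poly -{1}(prednK l0) ltnNge /=.
  have [|u0 _] := @unity_coef l l.-1; first by rewrite prednK.
  by apply: contra u0 => /leq_sizeP ->.
have lead1 : lead_coef (unity_poly l) = 1.
  by rewrite lead_coefE szQ coef_poly prednK // leqnn binn.
rewrite lead1 scale1r in Qs.
have szs : size s = l.-1 by rewrite -szQ Qs size_prod_XsubC.
apply: contrapT => H; have := @prod_root_rval s (p%:R - 1).
have -> : \prod_(z <- s) (- z) = (unity_poly l)`_0.
  rewrite -horner_coef0 Qs horner_prod; apply: eq_bigr => z _.
  by rewrite hornerXsubC sub0r.
rewrite (proj2 (unity_coef l0)) bin1 szs => [[z zs|_]].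
  have [|z0 zl] := @unity_root l z l0; first by rewrite Qs root_prod_XsubC.
  by split=> //; rewrite leNgt; apply/negP => zk; apply: H; exists z.
have := logn_mul_pred_lt p_prime pl lp l0.
rewrite -(ltr_nat rat) natrM -[p.-1]subn1 natrB ?(ltnW p1) //; lra.
Qed.

Lemma exists_root (l : nat) (y : L) : (0 < l)%N -> exists b, b ^+ l = y.
Proof.
move=> l0; have /closed_rootP[b] : size ('X^l - y%:P) != 1%N.
  by rewrite size_XnsubC // eqSS -lt0n.
by rewrite rootE hornerD hornerN hornerXn hornerC subr_eq0 => /eqP; exists b.
Qed.

End BackwardOrbit.

(** * The backward tree of a point and pairs of orbits in it *)

Section BackwardTree.
Variables (L : closedFieldType) (w : L -> \bar rat) (l : nat) (c : L).
Hypotheses (w_val : is_valuation w) (l_gt1 : (1 < l)%N) (c_lt0 : rval w c < 0).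

Let r := rval w c / l%:R.

Let l_gt0 : 0 < l%:R :> rat. Proof. by rewrite ltr0n ltnW. Qed.

Let l_gt1' : 1 < l%:R :> rat. Proof. by rewrite ltr1n. Qed.

Let lr : l%:R * r = rval w c.
Proof. by rewrite /r mulrCA divff ?mulr1 // lt0r_neq0. Qed.

Let r_lt0 : r < 0.
Proof. by rewrite /r pmulr_llt0 // invr_gt0. Qed.

Let c_lt_r : rval w c < r.
Proof. by rewrite /r ltr_pdivlMr // gtr_nMr. Qed.

Let c_neq0 : c != 0.
Proof.
apply: contraTneq c_lt0 => ->.
by rewrite /rval (proj2 (valuation_eqy w_val 0)) //= ltxx.
Qed.

Lemma rval_preimage x b : vgt w (rval w c) x -> b ^+ l = x + c ->
  b != 0 /\ rval w b = r.
Proof.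
move=> xc bl; have [xc0 vxc] := rval_addl w_val c_neq0 xc.
rewrite addrC -bl in xc0 vxc.
have b0 : b != 0 by move: xc0; rewrite expf_eq0 ltnW.
split=> //; move: vxc; rewrite rvalX // -lr; apply: mulfI.
exact: lt0r_neq0.
Qed.

(* Each preimage divides the valuation by [l], until it exceeds that of [c]. *)
Lemma exists_backward_node x : exists N y,
  [/\ iter N (fun z => z ^+ l - c) y = x, y != 0 & rval w y = r].
Proof.
have l0 : (0 < l)%N by exact: ltnW.
have step_gt y : vgt w (rval w c) y -> exists N z,
    [/\ iter N (fun z => z ^+ l - c) z = y, z != 0 & rval w z = r].
  move=> yc; have [b bl] := exists_root (y + c) l0.
  have [b0 vb] := rval_preimage yc bl.
  by exists 1%N, b; rewrite /= bl addrK.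
have lift y b : b ^+ l = y + c ->
    (exists N z, [/\ iter N (fun z => z ^+ l - c) z = b, z != 0 & rval w z = r]) ->
    exists N z, [/\ iter N (fun z => z ^+ l - c) z = y, z != 0 & rval w z = r].
  by move=> bl [N [z [Nz z0 vz]]]; exists N.+1, z; rewrite iterS Nz bl addrK.
(* At valuation w(c) the sum [y + c] may cancel, but any preimage [b] still has w(b) >= r > w(c), so
   one more preimage suffices. *)
have lowest y : vge w (rval w c) y -> exists N z,
    [/\ iter N (fun z => z ^+ l - c) z = y, z != 0 & rval w z = r].
  move=> yc; have [b bl] := exists_root (y + c) l0.
  apply: (lift _ _ bl); apply: step_gt.
  have : vge w (rval w c) (b ^+ l).
    by rewrite bl; apply: vgeD => //; rewrite /vge lexx orbT.
  rewrite /vge /vgt; have [//|b0] := eqVneq b 0.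
  rewrite expf_eq0 (negbTE b0) andbF /= rvalX // => vb.
  by apply: lt_le_trans c_lt_r _; rewrite ler_pdivrMr ?ltr0n // mulrC.
(* Below w(c), a preimage has valuation w(y)/l, at least w(y)/2 since w(y) < 0; [k] counts these
   halvings. *)
suff H k y : vge w ((2 ^ k)%:R * rval w c) y -> exists N z,
    [/\ iter N (fun z => z ^+ l - c) z = y, z != 0 & rval w z = r].
  pose k := Num.bound `|rval w x / rval w c|; apply: (H k).
  apply/orP; right.
  have kx : rval w x / rval w c < (2 ^ k)%:R.
    apply: le_lt_trans (ler_norm _) _.
    apply: lt_trans (archi_boundP (normr_ge0 _)) _.
    by rewrite ltr_nat ltn_expl.
  by rewrite -ler_ndivrMr // ltW.
elim: k y => [|k IH] y; first by rewrite expn0 mul1r; exact: lowest.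
have [yc _|yc] := leP (rval w c) (rval w y).
  by apply: lowest; rewrite /vge yc orbT.
have [-> _|y0] := eqVneq y 0; first by apply: lowest; rewrite /vge eqxx.
rewrite /vge (negbTE y0) /= => ky.
have [b bl] := exists_root (y + c) l0; apply: (lift _ _ bl); apply: IH.
have [yc0 vyc] : y + c != 0 /\ rval w (y + c) = rval w y.
  by apply: rval_addl => //; rewrite /vgt yc orbT.
have b0 : b != 0 by move: yc0; rewrite -bl expf_eq0 ltnW.
apply/orP; right; move: vyc; rewrite -bl rvalX // => vb.
have l2 : 2 <= l%:R :> rat by rewrite ler_nat.
have vb0 : rval w b < 0 by rewrite -(pmulr_rlt0 _ l_gt0) vb; exact: lt_trans yc _.
have := ler_wnM2r (ltW vb0) l2.
move: ky; rewrite -vb expnS natrM -mulrA; lra.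
Qed.

Definition conjugate_pair (q : L * L) : Prop :=
  [/\ q.1 != q.2, q.1 != 0, q.2 != 0, rval w q.1 = r & rval w q.2 = r].

(** On a conjugate pair this is the valuation of [(q.1 - q.2) / q.2], hence lies in the value group
    of any subfield containing both nodes. *)
Let rel_val (q : L * L) : rat := rval w (q.1 - q.2) - r.

Lemma rel_val_ge0 q : conjugate_pair q -> 0 <= rel_val q.
Proof.
move=> [q12 q1 q2 v1 v2]; rewrite subr_ge0.
have : vge w r (q.1 - q.2).
  by apply: vgeD; rewrite ?vgeN // /vge ?v1 ?v2 lexx orbT.
by rewrite /vge subr_eq0 (negbTE q12).
Qed.

Variable p : nat.
Hypotheses (p_prime : prime p) (wp : w p%:R = 1%E).

(** The second orbit is continued by an arbitrary preimage, the first by the one that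
    [exists_newton_preimage] finds near it. *)
Lemma conjugate_pair_step q : conjugate_pair q -> exists q',
  [/\ conjugate_pair q', q'.1 ^+ l = q.1 + c, q'.2 ^+ l = q.2 + c &
    newton_step p (logn p l) (- (l%:R - 1) * r) (rel_val q) (rel_val q')].
Proof.
move=> cq; have [q12 q1 q2 v1 v2] := cq; have l0 : (0 < l)%N by exact: ltnW.
have vgt1 : vgt w (rval w c) q.1 by rewrite /vgt v1 c_lt_r orbT.
have vgt2 : vgt w (rval w c) q.2 by rewrite /vgt v2 c_lt_r orbT.
have [b' bl'] := exists_root (q.2 + c) l0.
have [b'0 vb'] := rval_preimage vgt2 bl'.
have [||b [bl bb' st]] :=
    exists_newton_preimage w_val p_prime wp l_gt1 b'0 bl' q12.
- by rewrite vb'.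
- by have := rel_val_ge0 cq; rewrite subr_ge0 vb'.
have [b0 vb] := rval_preimage vgt1 bl.
by exists (b, b'); split=> //; rewrite vb' in st.
Qed.

Lemma exists_pair_orbit q0 : conjugate_pair q0 -> exists q : nat -> L * L,
  [/\ q 0%N = q0, forall n, conjugate_pair (q n),
    forall n, (q n.+1).1 ^+ l = (q n).1 + c /\ (q n.+1).2 ^+ l = (q n).2 + c &
    forall n, newton_step p (logn p l) (- (l%:R - 1) * r)
      (rel_val (q n)) (rel_val (q n.+1))].
Proof.
move=> cq0.
(* Off conjugate pairs [g] takes an arbitrary value, so that it is a total function to iterate. *)
have /choice[g gP] : forall q, exists q', conjugate_pair q ->
  [/\ conjugate_pair q', q'.1 ^+ l = q.1 + c, q'.2 ^+ l = q.2 + c &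
    newton_step p (logn p l) (- (l%:R - 1) * r) (rel_val q) (rel_val q')].
  move=> q; have [/conjugate_pair_step[q' Hq']|nq] := pselect (conjugate_pair q).
    by exists q'.
  by exists q.
have cq n : conjugate_pair (iter n g q0).
  by elim: n => // n /gP[].
exists (fun n => iter n g q0); split=> // n; have [_ H1 H2 H3] := gP _ (cq n).
  by split.
exact: H3.
Qed.

(** Two preimages of one point differ by the factor [1 + d], and [(1 + d) * b - b = d * b] has
    valuation w(d) + r. *)
Lemma conjugate_pair_unity_root y b d :
  vgt w (rval w c) y -> b ^+ l = y + c -> d != 0 -> (1 + d) ^+ l = 1 ->
  let q := ((1 + d) * b, b) in
  [/\ conjugate_pair q, q.1 ^+ l = y + c & rel_val q = rval w d].
Proof.
move=> yc bl d0 dl /=; have [b0 vb] := rval_preimage yc bl.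
have bl1 : ((1 + d) * b) ^+ l = y + c by rewrite exprMn dl mul1r.
have [b10 vb1] := rval_preimage yc bl1.
have E : (1 + d) * b - b = d * b by ring.
split=> //; last by rewrite /rel_val /= E rvalM // vb addrK.
by split=> //=; rewrite -subr_eq0 E mulf_neq0.
Qed.

Lemma exists_ramified_orbit (x : L) : l <> p ->
  - (l%:R - 1) * r <= (logn p l)%:R ->
  exists N (q : nat -> L * L),
  [/\ forall n, iter (N + n) (fun z => z ^+ l - c) (q n).1 = x /\
                iter (N + n) (fun z => z ^+ l - c) (q n).2 = x,
    forall n, (q n).1 != (q n).2 /\ (q n).2 != 0 &
    forall (E : nat) (e : nat -> nat) (B : nat), (0 < E)%N ->
      (forall n, (0 < e n)%N) ->
      (forall n, (E * e n)%:R * rval w (((q n).1 - (q n).2) / (q n).2)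
         \is a Num.int) ->
      exists n, (B <= (e n)`_p)%N].
Proof.
move=> lp; set D := _ * r => Da; have l0 : (0 < l)%N by exact: ltnW.
have D0 : 0 < D by rewrite /D mulNr -mulrN mulr_gt0 ?oppr_gt0 ?subr_gt0.
(* Since 0 < D <= v_p(l), the hypothesis on [c] already forces [p] to divide [l]. *)
have pl : (p %| l)%N.
  have : (0 < logn p l)%N by rewrite -(ltr0n rat); exact: lt_le_trans Da.
  by rewrite logn_gt0 mem_primes => /and3P[].
(* The starting value must avoid the fixed points of the recursion: a far root of unity if D =
   v_p(l), a near one if D is smaller. *)
have [d [d0 dl dP]] : exists d : L, [/\ d != 0, (1 + d) ^+ l = 1 &
    D < (logn p l)%:R /\ 1 <= (p%:R - 1) * rval w d \/
    D = (logn p l)%:R /\ (p%:R - 1) * rval w d < 1].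
  move: Da; rewrite le_eqVlt => /orP[/eqP Da|Da].
    have [d [d0 dl vd]] := exists_unity_root_far w_val p_prime wp pl l0 lp.
    by exists d; split=> //; right.
  have [d [d0 dl vd]] := exists_unity_root_near w_val p_prime wp pl l0.
  by exists d; split=> //; left.
have vd0 : 0 <= rval w d.
  by have := rval_unit_root_sub1 w_val l0 dl; rewrite /vge (negbTE d0).
have [N [y [Ny y0 vy]]] := exists_backward_node x.
have yc : vgt w (rval w c) y by rewrite /vgt vy c_lt_r orbT.
have [b bl] := exists_root (y + c) l0.
have [cq ql1 vq] := conjugate_pair_unity_root yc bl d0 dl.
have [q [q0 cqn qn st]] := exists_pair_orbit cq.
(* The successor appears because the initial pair consists of preimages of [y], one level further
   back. *)
exists N.+1, q; split=> [n|n|E e B E0 e0 He].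
- elim: n => [|n [IH1 IH2]].
    by rewrite addn0 !iterSr q0 /= ql1 bl addrK Ny.
  have [q1 q2] := qn n; rewrite addnS; split; rewrite iterSr.
    by rewrite q1 addrK.
  by rewrite q2 addrK.
- by have [] := cqn n.
apply: (newton_orbit_ramified p_prime (s := fun n => rel_val (q n))
          D0 st _ _ (E := E) B E0 e0).
- by rewrite q0 vq.
- by rewrite q0 vq.
move=> n; have := He n; have [q12 _ q2 _ v2] := cqn n.
by rewrite rvalM ?invr_eq0 ?subr_eq0 // rvalV // v2.
Qed.

End BackwardTree.

(** * Finite generation of the preimage fields and bounded degree of their elements *)

Section SimpleExtension.
Variables (K L : fieldType) (iota : {rmorphism K -> L}).
Local Notation "q ^i" := (map_poly iota q) (at level 2, format "q ^i").

Let in_simple (z x : L) := exists q, q^i.[z] = x.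

(* The [size P] powers of [q] are linearly dependent modulo [P]. *)
Lemma simple_ext_relation (P q : {poly K}) (z : L) : P != 0 -> root P^i z ->
  exists h : {poly K}, [/\ h != 0, (size h <= size P)%N & root h^i q^i.[z]].
Proof.
move=> P0 Pz; set N := size P.
have N0 : (0 < N)%N by rewrite size_poly_gt0.
(* Row [i] holds the coefficients of [q ^+ i] modulo [P]; having one more row than columns, [A] has
   a nonzero left kernel. *)
pose A : 'M[K]_(N, N.-1) := \matrix_i poly_rV (q ^+ i %% P).
have : kermx A != 0.
  rewrite kermx_eq0 -row_leq_rank -ltnNge.
  by apply: leq_ltn_trans (rank_leq_col _) _; rewrite prednK.
case/rowV0Pn => u /sub_kermxP uA u0; exists (rVpoly u).
have sz i : (size (q ^+ i %% P)%R <= N.-1)%N.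
  by rewrite -ltnS prednK // ltn_modp.
have modz i : (q ^+ i %% P)^i.[z] = q^i.[z] ^+ i.
  rewrite -horner_exp -rmorphXn /= [in RHS](divp_eq (q ^+ i) P).
  by rewrite rmorphD rmorphM /= hornerD hornerM (eqP Pz) mulr0 add0r.
split.
- by apply: contraNneq u0 => u00; rewrite -(rVpolyK u) u00 linear0.
- exact: size_poly.
have -> : rVpoly u = \sum_(i < N) u 0 i *: 'X^i.
  rewrite {1}[u]row_sum_delta linear_sum /=; apply: eq_bigr => i _.
  by rewrite linearZ /= rVpoly_delta.
have := congr1 (fun v => (rVpoly v)^i.[z]) uA.
rewrite mulmx_sum_row linear_sum rmorph_sum /= horner_sum linear0 rmorph0 horner0.
move=> E1; rewrite rootE rmorph_sum horner_sum; apply/eqP.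
rewrite -[RHS]E1; apply: eq_bigr => i _ /=.
rewrite map_polyZ hornerZ map_polyXn hornerXn rowK.
have -> (x : 'rV[K]_(N.-1)) : rVpoly (u 0 i *: x) = u 0 i *: rVpoly x.
  exact: linearZ.
by rewrite poly_rV_K // map_polyZ hornerZ modz.
Qed.

Lemma simple_ext_divring (z : L) : algebraicOver iota z ->
  divring_closed (mem [set x | in_simple z x]).
Proof.
move=> [P P0 Pz].
have inM x y : in_simple z x -> in_simple z y -> in_simple z (x * y).
  by move=> [q <-] [q' <-]; exists (q * q'); rewrite rmorphM hornerM.
have inV x : in_simple z x -> in_simple z x^-1.
  have [->|x0] := eqVneq x 0; first by rewrite invr0.
  move=> [q qx]; have [h [h0 _]] := simple_ext_relation q P0 Pz; rewrite qx.
  (* Removing the factor X^m from the relation leaves one with nonzero constant term [a]; writing it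
     as x k(x) + a = 0 gives 1/x = -k(x)/a. *)
  have [m [h' + hE]] := multiplicity_XsubC h 0; rewrite h0 /= hE subr0 => h'0.
  rewrite rmorphM rmorphXn /= map_polyX rootM => /orP[|]; last first.
    by rewrite rootE hornerXn expf_eq0 (negbTE x0) andbF.
  move: h'0; elim/poly_ind: h' {hE} => [|k a _].
    by rewrite root0.
  rewrite rootE hornerMXaddC mulr0 add0r => a0.
  rewrite rmorphD rmorphM /= map_polyX map_polyC rootE hornerMXaddC => /eqP ka.
  exists ((- a^-1) *: (k \Po q)).
  rewrite map_polyZ hornerZ map_comp_poly horner_comp qx rmorphN fmorphV /=.
  have ia0 : iota a != 0 by rewrite fmorph_eq0.
  apply: (mulIf x0); rewrite mulVf // -mulrA (_ : _ * x = - iota a).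
    by rewrite mulNr mulrN opprK mulVf.
  by apply/eqP; rewrite -addr_eq0 ka.
split=> [|x y|x y]; rewrite !in_setE /=.
- by exists 1; rewrite rmorph1 hornerE.
- by move=> [q <-] [q' <-]; exists (q - q'); rewrite rmorphB !hornerE.
- by move=> xz yz; apply: inM => //; exact: inV.
Qed.

Hypothesis alg : forall x : L, algebraicOver iota x.
Hypothesis K0 : has_pchar0 K.

Lemma exists_primitive_element (s : seq L) :
  exists z, forall x, x \in s -> in_simple z x.
Proof.
elim: s => [|x s [z IH]]; first by exists 0.
have [[P P0 Px] [Q Q0 Qz]] := (alg x, alg z).
have [n [[qx xE] [qz zE]]] := pchar0_PET P0 Px Q0 Qz K0.
exists (z *+ n - x) => y; rewrite inE => /orP[/eqP ->|/IH[q <-]].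
  by exists qx.
by exists (q \Po qz); rewrite map_comp_poly horner_comp zE.
Qed.

(** K(S) lies in K[z] for a primitive element [z], and [simple_ext_relation] bounds all degrees by
    the polynomial of [z] alone. *)
Lemma adjoin_bounded_degree (S : set L) (s : seq L) :
  (forall x, S x -> x \in s) -> exists N, forall x, adjoin iota S x ->
    exists h : {poly K}, [/\ h != 0, (size h <= N)%N & root h^i x].
Proof.
move=> Ss; have [z zs] := exists_primitive_element s.
have [P P0 Pz] := alg z; exists (size P) => x Sx.
suff [q <-] : in_simple z x by exact: simple_ext_relation.
apply: Sx; split; last by move=> y /Ss /zs.
split; last by apply: simple_ext_divring; exists P.
by move=> _ [k _ <-]; exists k%:P; rewrite map_polyC hornerC.
Qed.

End SimpleExtension.

Lemma adjoin_divring (K L : fieldType) (iota : {rmorphism K -> L}) (S : set L) :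
  divring_closed (mem (adjoin iota S)).
Proof.
split=> [|x y|x y]; rewrite !in_setE.
- by move=> E [[_ [E1 _ _]] _]; rewrite -in_setE.
- move=> Sx Sy E HE; have [[_ [_ EB _]] _] := HE.
  by rewrite -in_setE; apply: EB; rewrite in_setE; [exact: Sx|exact: Sy].
- move=> Sx Sy E HE; have [[_ [_ _ ED]] _] := HE.
  by rewrite -in_setE; apply: ED; rewrite in_setE; [exact: Sx|exact: Sy].
Qed.

Lemma iter_preimage_finite (L : closedFieldType) (l : nat) (c a : L) (n : nat) :
  (0 < l)%N -> exists s : seq L, forall b,
    iter n (horner ('X^l - c%:P)) b = a -> b \in s.
Proof.
move=> l0; elim: n => [|n [s IH]].
  by exists [:: a] => b /= ->; rewrite mem_head.
have /choice[rts rtsP] : forall y, exists r : seq L,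
    forall b, ('X^l - c%:P).[b] = y -> b \in r.
  move=> y; have [r rP] := closed_field_poly_normal ('X^l - (c + y)%:P).
  exists r => b by_.
  have P0 : 'X^l - (c + y)%:P != 0 by rewrite -size_poly_eq0 size_XnsubC.
  have : root ('X^l - (c + y)%:P) b.
    rewrite rootE -by_ !(hornerD, hornerN, hornerXn, hornerC); apply/eqP; ring.
  by rewrite {1}rP rootZ ?lead_coef_eq0 // root_prod_XsubC.
exists (flatten [seq rts y | y <- s]) => b; rewrite iterSr => /IH fb.
by apply/flattenP; exists (rts ('X^l - c%:P).[b]); [exact: map_f|exact: rtsP].
Qed.

(** * Finiteness of the ramification index *)

Section RamificationIndex.
Variables (K L : fieldType) (iota : {rmorphism K -> L}).
Variables (v : K -> \bar rat) (w : L -> \bar rat) (g : rat) (E : set L) (N : nat).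
Hypotheses (w_val : is_valuation w) (w_ext : forall x, w (iota x) = v x).
Hypothesis g_gt0 : 0 < g.
Hypothesis v_group : value_group v setT = [set g *~ m | m in [set: int]].
Hypotheses (E_div : divring_closed (mem E)) (E_iota : range iota `<=` E).
Hypothesis E_deg : forall x, E x ->
  exists h : {poly K}, [/\ h != 0, (size h <= N)%N & root (map_poly iota h) x].

Let G := value_group w E.

Let G_base m : G (g *~ m).
Proof.
have : value_group v setT (g *~ m) by rewrite v_group; exists m.
by move=> [x _ vx]; exists (iota x); [exact: E_iota|rewrite w_ext].
Qed.

Let GE q : G q -> exists2 x, E x /\ x != 0 & rval w x = q.
Proof.
move=> [x Ex wx]; exists x; last by rewrite /rval wx.
by split=> //; apply/eqP => x0; move: wx; rewrite x0 (proj2 (valuation_eqy w_val 0)).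
Qed.

Lemma value_group_sub q q' : G q -> G q' -> G (q - q').
Proof.
move=> /GE[x [Ex x0] <-] /GE[y [Ey y0] <-]; have [_ _ EV] := E_div.
exists (x / y).
  by have := EV x y; rewrite !in_setE; apply.
by rewrite rvalE ?mulf_neq0 ?invr_eq0 // rvalM ?invr_eq0 // rvalV.
Qed.

(* Two terms of minimal valuation in a relation of degree < N give
   [(j - i) w(x)] in the value group of [K]. *)
Let G_bounded q : G q -> exists k, N`!%:R * q = g *~ k.
Proof.
move=> /GE[x [Ex x0] <-]; have [h [h0 hN hx]] := E_deg Ex.
have Kval (a : K) : a != 0 -> exists m, rval w (iota a) = g *~ m.
  move=> a0; have : value_group v setT (rval w (iota a)).
    by exists a => //; rewrite -w_ext rvalE // fmorph_eq0.
  by rewrite v_group => -[m _ <-]; exists m.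
move: hx; rewrite rootE horner_coef size_map_poly => /eqP sum0.
have ht : ((size h).-1 < size h)%N by rewrite prednK ?size_poly_gt0.
have [|i [j [ij ti tj E1]]] := sum0_rval_eq w_val (i0 := Ordinal ht) sum0.
  by rewrite mulf_neq0 ?expf_neq0 // coef_map fmorph_eq0 -lead_coefE lead_coef_eq0.
move: ti tj E1; rewrite !coef_map !mulf_eq0 !negb_or !fmorph_eq0.
move=> /andP[hi _] /andP[hj _].
have [mi vi] := Kval _ hi; have [mj vj] := Kval _ hj.
rewrite !rvalM ?expf_neq0 ?fmorph_eq0 // !rvalX // vi vj => E1.
have d : ((j - i) %| N`!)%N.
  apply: dvdn_fact; rewrite subn_gt0 ij /=.
  by apply: leq_trans (leq_subr _ _) _; apply: leq_trans hN; exact: ltnW.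
exists ((mi - mj) * (N`! %/ (j - i))%N).
rewrite -{1}(divnK d) natrM -mulrA natrB; last exact: ltnW.
have -> : (j%:R - i%:R) * rval w x = g *~ (mi - mj).
  rewrite mulrzBr; lra.
by rewrite mulrzA -pmulrn mulr_natl.
Qed.

(** The value group lies between gZ and (g/N!)Z, so it is infinite cyclic; its positive generator
    [h0] satisfies g = e h0. *)
Lemma exists_ramification_index :
  exists e, [/\ (0 < e)%N, has_ramification_index v w E e &
    forall q, G q -> e%:R * q / g \is a Num.int].
Proof.
have g0 : g != 0 by exact: lt0r_neq0.
pose T : rat := N`!%:R; have T0 : 0 < T by rewrite ltr0n fact_gt0.
pose h k := g *~ k / T.
pose pos k := (0 < k)%N && `[< G (h k%:Z) >].
have posT : exists k, pos k.
  exists N`!; rewrite /pos fact_gt0; apply/asboolP.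
  rewrite /h -pmulrn -mulr_natr mulfK ?lt0r_neq0 //.
  by have := G_base 1; rewrite mulr1z.
have [k0 /andP[k00 /asboolP Gk0] k0min] := ex_minnP posT.
have GN q : G q -> G (- q).
  move=> Gq; rewrite -[- q]sub0r; apply: value_group_sub => //.
  by have := G_base 0; rewrite mulr0z.
have GD q q' : G q -> G q' -> G (q + q').
  by move=> Gq Gq'; rewrite -[q']opprK; apply: value_group_sub => //; exact: GN.
have GMn q n : G q -> G (q *+ n).
  move=> Gq; elim: n => [|n IH]; first by have := G_base 0; rewrite mulr0z.
  by rewrite mulrS; apply: GD.
have GMz q m : G q -> G (q *~ m).
  move=> Gq; case: m => n; first exact: GMn.
  by rewrite NegzE mulrNz; apply: GN; exact: GMn.
(* Euclidean division by the least positive [k0] shows that [h k0] generates: a nonzero remainder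
   would be a smaller choice. *)
have GhP q : G q -> exists m : int, q = h k0%:Z *~ m.
  move=> Gq; have [k kE] := G_bounded Gq.
  have qE : q = h k by rewrite /h -kE mulrAC divff ?mul1r ?lt0r_neq0.
  have rE : h (k %% k0%:Z)%Z = q - h k0%:Z *~ (k %/ k0%:Z)%Z.
    by rewrite qE /h -!(mulrzr g) -(mulrzr (_ / T)) /modz rmorphB rmorphM /=; ring.
  have Gr : G (h (k %% k0%:Z)%Z).
    by rewrite rE; apply: value_group_sub => //; exact: GMz.
  exists (k %/ k0%:Z)%Z; apply/eqP; rewrite -subr_eq0 -rE.
  have r0 : (0 <= (k %% k0%:Z)%Z) by apply: modz_ge0; rewrite gt_eqF // ltz_nat.
  have rk : ((k %% k0%:Z)%Z < k0%:Z) by apply: ltz_pmod; rewrite ltz_nat.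
  move: r0 rk Gr; case: (k %% k0%:Z)%Z => // [[|n]] _ nk Gr.
    by rewrite /h mulr0z mul0r.
  have := k0min n.+1; rewrite /pos /=; have -> : `[< G (h n.+1%:Z) >] by apply/asboolP.
  by move=> /(_ isT); rewrite leqNgt; move: nk; rewrite ltz_nat => ->.
set h0 := h k0%:Z in Gk0 GhP.
have h0_gt0 : 0 < h0 by rewrite /h0 /h divr_gt0 // -pmulrn pmulrn_lgt0.
have [e e0 eE] : exists2 e : nat, (0 < e)%N & g = h0 *+ e.
  have [|m mE] := GhP g; first by have := G_base 1; rewrite mulr1z.
  have : 0 < m by rewrite -(pmulrz_rgt0 _ h0_gt0) -mE.
  by case: m mE => // m mE m0; exists m; rewrite // -ltz_nat.
exists e; split=> //; last first.
  move=> q /GhP[m ->]; rewrite eE -[h0 *+ e]mulr_natl -[h0 *~ m]mulrzr.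
  have -> : e%:R * (h0 * m%:~R) / (e%:R * h0) = m%:~R :> rat.
    by field; rewrite lt0r_neq0 //= pnatr_eq0 -lt0n.
  exact: intr_int.
rewrite /has_ramification_index v_group.
pose coset q := [set q + g' | g' in [set g *~ m | m in [set: int]]].
have cosetE q m : coset (q + g *~ m) = coset q.
  apply/seteqP; split=> z [_ [k _ <-] <-].
    exists (g *~ (m + k)); last by rewrite mulrzDr addrA.
    by exists (m + k).
  exists (g *~ (k - m)); last by rewrite mulrzBr; ring.
  by exists (k - m).
(* The multiples of [h0] by 0, ..., e - 1 represent every coset of gZ; their pairwise distinctness
   follows by reduction modulo [e]. *)
have -> : [set coset q | q in G] = [set coset (h0 *+ i) | i in `I_e].
  apply/seteqP; split=> C [].
    move=> q /GhP[m qE] <-; have m0 : (0 <= (m %% e%:Z)%Z).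
      by apply: modz_ge0; rewrite gt_eqF // ltz_nat.
    exists `|(m %% e%:Z)%Z|%N.
      by rewrite /= -ltz_nat gez0_abs // ltz_pmod // ltz_nat.
    have -> : q = h0 *~ (m %% e%:Z)%Z + g *~ (m %/ e%:Z)%Z.
      rewrite qE eE (pmulrn h0 e) -mulrzA -mulrzDr; congr (_ *~ _).
      by rewrite addrC mulrC -divz_eq.
    by rewrite cosetE pmulrn gez0_abs.
  by move=> i _ <-; exists (h0 *+ i) => //; exact: GMn.
apply: inj_card_eq => i j; rewrite !in_setE /= => ie je Eij.
have : coset (h0 *+ i) (h0 *+ i).
  by exists 0; rewrite ?addr0 //; exists 0; rewrite ?mulr0z.
rewrite Eij => -[_ [k _ <-] E1].
have Eijk : i%:Z = k * e%:Z + j%:Z.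
  apply: (@intr_inj rat); apply: (mulfI (lt0r_neq0 h0_gt0)).
  transitivity (h0 *+ i); first by rewrite pmulrn mulrzr.
  rewrite -E1 eE -(mulrzr (h0 *+ e)) -[h0 *+ e]mulr_natr -[h0 *+ j]mulr_natr.
  rewrite rmorphD rmorphM /= -!pmulrn; ring.
have : (i%:Z = j%:Z %[mod e%:Z])%Z by rewrite Eijk modzMDl.
by rewrite !modz_small ?lez_nat ?ltz_nat // => -[].
Qed.

End RamificationIndex.

(** * Wild ramification in the tower of preimage fields *)

Theorem theorem5p5 (K : fieldType) (v : K -> \bar rat) (p : nat)
  (v_discrete : discrete_valuation v)
  (v_complete : val_complete v)
  (v_residue : residue_pchar v p)
  (v_normalized : v p%:R = 1%E)
  (Kbar : closedFieldType) (iota : {rmorphism K -> Kbar})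
  (Kbar_closure : is_algebraic_closure iota)
  (w : Kbar -> \bar rat)
  (w_valuation : is_valuation w)
  (w_extends : forall x : K, w (iota x) = v x)
  (l : nat) (l_ge2 : (2 <= l)%N) (l_neq_p : l <> p)
  (c : Kbar)
  (f_separable : separable_poly ('X^l - c%:P))
  (alpha : K)
  (c_ge : (nu_infty v l <= w c)%E) (c_lt0 : (w c < 0)%E) :
  infinitely_wildly_ramified v w p
    (preimage_field iota ('X^l - c%:P) alpha).
Proof.
have [_ [g g_gt0 v_group]] := v_discrete; have [p_prime _] := v_residue.
have l_gt0 : (0 < l)%N by exact: ltnW.
have wp : w p%:R = 1%E by rewrite -(rmorph_nat iota) w_extends.
have K0 : has_pchar0 K.
  move=> q; rewrite !inE; apply/negP => /andP[q_prime /eqP q0].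
  have [+ _] := rval_nat w_valuation p_prime wp (prime_gt0 q_prime).
  by rewrite -(rmorph_nat iota) q0 rmorph0 eqxx.
have c0 : c != 0.
  by apply/eqP => c0; move: c_lt0; rewrite c0 (proj2 (valuation_eqy w_valuation 0)).
have c_lt0' : rval w c < 0 by move: c_lt0; rewrite (rvalE w_valuation c0) lte_fin.
(* Multiplying the lower bound on w(c) by (l - 1)/l turns it into D <= v(l). *)
have D_le : - (l%:R - 1) * (rval w c / l%:R) <= (logn p l)%:R.
  have [ln0 vl] := rval_nat w_valuation p_prime wp l_gt0.
  move: c_ge; rewrite /nu_infty -w_extends rmorph_nat.
  rewrite (rvalE w_valuation ln0) (rvalE w_valuation c0) vl -EFinM -EFinN lee_fin => H.
  have l0 : 0 < l%:R :> rat by rewrite ltr0n.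
  have l1 : 0 < l%:R - 1 :> rat by rewrite subr_gt0 ltr1n.
  rewrite mulrA ler_pdivrMr // mulNr lerNl.
  have := ler_wpM2l (ltW l1) H.
  have -> : (l%:R - 1) * - (l%:R / (l%:R - 1) * (logn p l)%:R) =
    - ((logn p l)%:R * l%:R) :> rat by field; rewrite lt0r_neq0.
  by [].
(* Since v(p) = 1 lies in gZ, [m = 1/g] is the absolute ramification index of [K]. *)
have [m m_gt0 gE] : exists2 m : nat, (0 < m)%N & 1 = g *+ m.
  have : value_group v setT 1 by exists p%:R.
  rewrite v_group => -[[m|m] _ mE].
    exists m => //; rewrite lt0n; apply/eqP => m0; move: mE.
    by rewrite m0 mulr0z => /eqP; rewrite eq_sym oner_eq0.
  have : g *~ Negz m < 0 by rewrite pmulrz_rlt0.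
  by rewrite mE ltr10.
have [N [q [q_iter q_neq q_ram]]] :=
  exists_ramified_orbit w_valuation l_ge2 c_lt0' p_prime wp (iota alpha) l_neq_p D_le.
pose Kn := preimage_field iota ('X^l - c%:P) alpha.
have q_in n : Kn (N + n)%N (q n).1 /\ Kn (N + n)%N (q n).2.
  have fE : horner ('X^l - c%:P) =1 (fun z => z ^+ l - c).
    by move=> z; rewrite hornerD hornerN hornerXn hornerC.
  by have [q1 q2] := q_iter n; split; apply: sub_gen_smallest; rewrite /= (eq_iter fE).
have /choice[e eP] : forall n, exists e, [/\ (0 < e)%N,
    has_ramification_index v w (Kn n) e &
    forall x, value_group w (Kn n) x -> e%:R * x / g \is a Num.int].
  move=> n; have [s sP] := iter_preimage_finite c (iota alpha) n l_gt0.
  have [d dP] := adjoin_bounded_degree Kbar_closure K0 sP.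
  apply: (exists_ramification_index w_valuation w_extends g_gt0 v_group _ _ dP).
    exact: adjoin_divring.
  by move=> x [k _ <-] E [[E_iota _] _]; apply: E_iota; exists k.
(* Here m e = e/g, so the integrality required of the orbit says that the quotient built from the
   pair has its valuation in the value group of the field [Kn (N + n)]. *)
move=> B; have [||n Bn] := q_ram m (fun n => e (N + n)%N) B m_gt0.
- by move=> n; have [] := eP (N + n)%N.
- move=> n; have [_ _ eint] := eP (N + n)%N; have [q1 q2] := q_in n.
  have [q12 q20] := q_neq n; have [_ EB ED] := adjoin_divring iota
    [set beta | iter (N + n) (horner ('X^l - c%:P)) beta = iota alpha].
  have -> : (m * e (N + n)%N)%:R = (e (N + n)%N)%:R / g :> rat.
    rewrite natrM mulrC; congr (_ * _); apply: (mulIf (lt0r_neq0 g_gt0)).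
    by rewrite mulVf ?lt0r_neq0 // mulr_natl -gE.
  rewrite mulrAC; apply: eint; exists (((q n).1 - (q n).2) / (q n).2).
    by rewrite -in_setE; apply: ED; last rewrite in_setE //; apply: EB; rewrite in_setE.
  by rewrite (rvalE w_valuation) // mulf_neq0 ?invr_eq0 ?subr_eq0.
by exists (N + n)%N, (e (N + n)%N); have [] := eP (N + n)%N.
Qed.
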